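(* Let $(\Omega,\mathcal{A},\mu)$ be a measure space, $\mathcal{X}$ a set, and $k:\mathcal{X}\times\Omega\to\mathbb{C}$ a function such that for every $x\in\mathcal{X}$ the function $\omega\mapsto k(x,\omega)$ is in $L_2(\Omega,\mu)$. Then the reproducing kernel Hilbert space $\mathcal{H}$ over $\mathcal{X}$ associated with the kernel $$K(x,y)=\int_\Omega k(x,\omega)\,\overline{k(y,\omega)}\,d\mu(\omega),\qquad x,y\in\mathcal{X},$$ is the range of the operator $S$ from $L_2(\Omega,\mu)$ into the space of functions $\mathcal{X}\to\mathbb{C}$ given by $$(Sa)(y)=\int_\Omega a(\omega)\,k(y,\omega)\,d\mu(\omega),\qquad y\in\mathcal{X},$$ with norm $\|f\|_{\mathcal{H}}=\inf\{\|a\|_{L_2(\Omega,\mu)} : a\in L_2(\Omega,\mu),\ Sa=f\}$ for $f\in\mathcal{H}$.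
   Context: A reproducing kernel Hilbert space over $\mathcal{X}$ with reproducing kernel $K$ is a Hilbert space $\mathcal{H}$ of functions $\mathcal{X}\to\mathbb{C}$ with $K(\cdot,y)\in\mathcal{H}$ and $f(y)=\langle f,K(\cdot,y)\rangle$ for all $f\in\mathcal{H}$, $y\in\mathcal{X}$ (scalar products are linear in the first argument). It is uniquely determined by $K$. *)

(* Defs.v *)
From HB Require Import structures.
From mathcomp Require Import all_boot all_order all_algebra.
From mathcomp Require Import complex.
From mathcomp Require Import all_classical all_reals all_analysis.

Set Implicit Arguments.
Unset Strict Implicit.
Unset Printing Implicit Defensive.

Import Order.TTheory GRing.Theory Num.Theory.
Import numFieldNormedType.Exports.

Local Open Scope classical_set_scope.
Local Open Scope ring_scope.
Local Open Scope complex_scope.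

(* Borel measurability for C identified with R * R *)
Definition cmeasurable {R : realType} {d : measure_display}
    {T : measurableType d} (f : T -> R[i]) : Prop :=
  measurable_fun setT (fun w => complex.Re (f w)) /\
  measurable_fun setT (fun w => complex.Im (f w)).

(* junk value (componentwise, that of [Rintegral]) when [f] is not integrable *)
Definition cintegral {R : realType} {d : measure_display}
    {T : measurableType d} (mu : {measure set T -> \bar R}) (f : T -> R[i]) :
    R[i] :=
  Rintegral mu setT (fun w => complex.Re (f w)) +i*
  Rintegral mu setT (fun w => complex.Im (f w)).

Definition cL2enorm {R : realType} {d : measure_display}
    {T : measurableType d} (mu : {measure set T -> \bar R}) (f : T -> R[i]) :
    \bar R :=
  Lnorm mu 2%:E (fun w => (Normc.normc (f w))%:E).

(* Elements of L_2 are given by representatives; [cintegral] and the norm do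
   not depend on the choice of the representative. *)
Definition cL2 {R : realType} {d : measure_display}
    {T : measurableType d} (mu : {measure set T -> \bar R}) :
    set (T -> R[i]) :=
  [set f | cmeasurable f /\ (cL2enorm mu f < +oo)%E].

Definition cL2norm {R : realType} {d : measure_display}
    {T : measurableType d} (mu : {measure set T -> \bar R}) (f : T -> R[i]) :
    R :=
  fine (cL2enorm mu f).

Definition norm_of_inner {R : realType} {X : Type}
    (inner : (X -> R[i]) -> (X -> R[i]) -> R[i]) (f : X -> R[i]) : R :=
  Num.sqrt (complex.Re (inner f f)).

(* [inner] is a total function but is only constrained on [carrier]; it is
   linear in the first argument. *)
Record hilbert_fun_space (R : realType) (X : Type) := HilbertFunSpace {
  carrier : set (X -> R[i]) ;
  inner : (X -> R[i]) -> (X -> R[i]) -> R[i] ;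
  carrier_submod : submod_closed [in carrier] ;
  inner_linear : forall (a : R[i]) (f g h : X -> R[i]),
    carrier f -> carrier g -> carrier h ->
    inner (a *: f + g) h = a * inner f h + inner g h ;
  inner_conj : forall f g : X -> R[i],
    carrier f -> carrier g -> inner g f = (inner f g)^* ;
  inner_pos : forall f : X -> R[i],
    carrier f -> f != 0 -> 0 < inner f f ;
  carrier_complete : forall u : nat -> X -> R[i],
    (forall n, carrier (u n)) ->
    (forall e : R, 0 < e -> exists N : nat, forall m n : nat,
       (N <= m)%N -> (N <= n)%N -> norm_of_inner inner (u m - u n) < e) ->
    exists2 f : X -> R[i], carrier f &
      (fun n : nat => norm_of_inner inner (u n - f)) @ \oo --> (0 : R)
}.

Definition hnorm {R : realType} {X : Type} (H : hilbert_fun_space R X)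
    (f : X -> R[i]) : R :=
  norm_of_inner (inner H) f.

Definition is_rkhs {R : realType} {X : Type} (K : X -> X -> R[i])
    (H : hilbert_fun_space R X) : Prop :=
  (forall y : X, carrier H (fun x => K x y)) /\
  (forall (f : X -> R[i]) (y : X),
     carrier H f -> f y = inner H f (fun x => K x y)).

Definition int_kernel {R : realType} {d : measure_display}
    {T : measurableType d} {X : Type} (mu : {measure set T -> \bar R})
    (k : X -> T -> R[i]) (x y : X) : R[i] :=
  cintegral mu (fun w => k x w * (k y w)^*).

Definition int_op {R : realType} {d : measure_display}
    {T : measurableType d} {X : Type} (mu : {measure set T -> \bar R})
    (k : X -> T -> R[i]) (a : T -> R[i]) (y : X) : R[i] :=
  cintegral mu (fun w => a w * k y w).

(* Main.v *)
Require Import Defs.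
From HB Require Import structures.
From mathcomp Require Import all_boot all_order all_algebra.
From mathcomp Require Import complex.
From mathcomp Require Import all_classical all_reals all_analysis.
From mathcomp Require Import measurable_realfun.
From mathcomp Require Import ring lra zify.

Import Order.TTheory GRing.Theory Num.Theory.
Import numFieldNormedType.Exports.
Set Implicit Arguments.
Unset Strict Implicit.
Unset Printing Implicit Defensive.

Local Open Scope classical_set_scope.
Local Open Scope ring_scope.
Local Open Scope complex_scope.

(** The operator S sends [a] to the function whose value at [y] is the inner
    product of [a] with the conjugate [phi y] of [k y], and the kernel K is the
    Gram matrix of the family [phi]. In a reproducing kernel Hilbert space H
    with kernel K the functions K(., y) form a family with the same Gram
    matrix, and the corresponding operator is the identity, by the reproducing
    property. So the theorem compares two complete spaces that carry families
    with the same Gram matrix.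

    For a family [phi] in a complete space, a function [f] has the form
    [<v, phi .>] with [|v|^2 <= C] exactly when
    [2 Re (sum_i c_i conj (f y_i)) <= C + |sum_i c_i phi (y_i)|^2] for all
    finite combinations. Necessity is [0 <= |sum_i c_i phi (y_i) - v|^2];
    sufficiency is the Riesz representation theorem, [riesz_min], proved by
    minimizing [|s|^2 - 2 Re L(s)] over the span of the family. The condition
    mentions the Gram matrix only, so [v] can be replaced by a vector of the
    other space that is not longer ([analysis_transfer]). Between [L_2] and H
    this gives, in both directions, that H is the range of S and that the norm
    of H is the infimum, which is attained ([rkhs_range]).

    Existence of H: each function of the range of S has a preimage orthogonal
    to the kernel of S, again by [riesz_min]. The inner product of two such
    preimages makes the range a Hilbert space with the reproducing property
    ([range_space_is_rkhs]).

    It remains to see that [L_2] is complete. This is reduced to real and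
    imaginary parts, and [sqdist_complete] proves it there by a fast
    subsequence and Fatou's lemma. *)

(** * Real and imaginary parts *)

Section ComplexParts.
Context {R : realType}.
Implicit Types z w : R[i].

Lemma cReD z w : complex.Re (z + w) = complex.Re z + complex.Re w.
Proof. by case: z w => [a b] [c d]. Qed.

Lemma cImD z w : complex.Im (z + w) = complex.Im z + complex.Im w.
Proof. by case: z w => [a b] [c d]. Qed.

Lemma cReM z w : complex.Re (z * w) =
  complex.Re z * complex.Re w - complex.Im z * complex.Im w.
Proof. by case: z w => [a b] [c d]. Qed.

Lemma cImM z w : complex.Im (z * w) =
  complex.Re z * complex.Im w + complex.Im z * complex.Re w.
Proof. by case: z w => [a b] [c d]. Qed.

Lemma cRe_conjc z : complex.Re (conjc z) = complex.Re z.
Proof. by case: z. Qed.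

Lemma cIm_conjc z : complex.Im (conjc z) = - complex.Im z.
Proof. by case: z. Qed.

Lemma complex_ext z w :
  complex.Re z = complex.Re w -> complex.Im z = complex.Im w -> z = w.
Proof. by case: z w => [a b] [c d] /= -> ->. Qed.

Lemma conj_involutive z : conjc (conjc z) = z.
Proof. by case: z => a b /=; rewrite opprK. Qed.

Lemma conjcB z w : conjc (z - w) = conjc z - conjc w.
Proof. by case: z w => [a b] [c d]; apply: complex_ext => //=; rewrite opprD. Qed.

Lemma cReM_eq0 z : (forall c, complex.Re (c * z) = 0) -> z = 0.
Proof.
case: z => a b h; have := h 1; have := h 'i => /=.
rewrite !(mul0r, mul1r, subr0, sub0r) => /eqP; rewrite oppr_eq0 => /eqP -> -> //.
Qed.

(** The first-order condition behind every orthogonality statement below: a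
    quadratic function of t that is minimal at t = 0 has no linear term. *)
Lemma quadratic_ge0_linear0 (A B : R) :
  (forall t, 0 <= A * t ^+ 2 + 2 * B * t) -> B = 0.
Proof.
move=> h; apply: contrapT => /eqP B0.
have A0 : 0 <= A by move: (h 1) (h (-1)); nra.
have A1 : 0 < A + 1 by lra.
(* A + 1 replaces the optimal denominator A, which may vanish. *)
have := h (- B / (A + 1)).
set u := (A + 1)^-1.
have u0 : 0 < u by rewrite invr_gt0.
have uA : A * u = 1 - u by rewrite /u; field; lra.
have -> : A * (- B * u) ^+ 2 + 2 * B * (- B * u) = B ^+ 2 * u * (A * u - 2) by ring.
rewrite uA.
have : 0 < B ^+ 2 * u by rewrite mulr_gt0// exprn_even_gt0.
nra.
Qed.

End ComplexParts.

(** * Complete semi-inner product spaces *)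

(** The form may be degenerate and only the vectors of [dom] matter, so that
    both [L_2], given by representatives, and a Hilbert space of functions are
    instances with no quotient or subtype. Completeness provides some limit;
    it is determined up to a vector of seminorm zero. *)
Record semi_hilbert (R : realType) (V : lmodType R[i]) := SemiHilbert {
  dom : set V;
  ip : V -> V -> R[i];
  dom0 : dom 0;
  dom_lin : forall (a : R[i]) u v, dom u -> dom v -> dom (a *: u + v);
  ip_lin : forall (a : R[i]) u v w, dom u -> dom v -> dom w ->
    ip (a *: u + v) w = a * ip u w + ip v w;
  ip_conj : forall u v, dom u -> dom v -> ip v u = conjc (ip u v);
  ip_ge0 : forall u, dom u -> 0 <= complex.Re (ip u u);
  dom_complete : forall u : nat -> V, (forall n, dom (u n)) ->
    (forall e : R, 0 < e -> exists N : nat, forall m n : nat,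
       (N <= m)%N -> (N <= n)%N ->
       Num.sqrt (complex.Re (ip (u m - u n) (u m - u n))) < e) ->
    exists2 v : V, dom v &
      (fun n => Num.sqrt (complex.Re (ip (u n - v) (u n - v)))) @ \oo --> (0 : R)
}.

Section SemiHilbertTheory.
Context {R : realType} {V : lmodType R[i]} (E : semi_hilbert V).
Implicit Types (u v w : V) (c : R[i]) (t : R).
Local Notation D := (dom E).
Local Notation "<| u , v |>" := (ip E u v) (format "<| u ,  v |>").

(** All minimization arguments take place in the underlying real space, where
    [rip] is a symmetric bilinear form. *)
Definition rip u v : R := complex.Re <|u, v|>.
Definition sqn u : R := rip u u.

Lemma domZ c u : D u -> D (c *: u).
Proof. by move=> Du; rewrite -[_ *: _]addr0; apply: dom_lin => //; exact: dom0. Qed.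

Lemma domD u v : D u -> D v -> D (u + v).
Proof. by move=> Du Dv; rewrite -[u]scale1r; exact: dom_lin. Qed.

Lemma domB u v : D u -> D v -> D (u - v).
Proof. by move=> Du Dv; rewrite -scaleN1r; apply: domD => //; exact: domZ. Qed.

Lemma ipD u v w : D u -> D v -> D w -> <|u + v, w|> = <|u, w|> + <|v, w|>.
Proof. by move=> *; rewrite -{1}[u]scale1r ip_lin// mul1r. Qed.

Lemma ip0l w : D w -> <|0, w|> = 0.
Proof.
move=> Dw; apply: (@addrI _ <|0, w|>).
by rewrite -ipD ?addr0//; exact: dom0.
Qed.

Lemma ipZ c u w : D u -> D w -> <|c *: u, w|> = c * <|u, w|>.
Proof.
move=> Du Dw; rewrite -[c *: u]addr0 ip_lin ?ip0l ?addr0//; exact: dom0.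
Qed.

Lemma ipB u v w : D u -> D v -> D w -> <|u - v, w|> = <|u, w|> - <|v, w|>.
Proof. by move=> *; rewrite -scaleN1r ipD ?ipZ ?mulN1r//; exact: domZ. Qed.

Lemma ripC u v : D u -> D v -> rip u v = rip v u.
Proof. by move=> *; rewrite /rip ip_conj// cRe_conjc. Qed.

Lemma ripDl u v w : D u -> D v -> D w -> rip (u + v) w = rip u w + rip v w.
Proof. by move=> *; rewrite /rip ipD// cReD. Qed.

Lemma ripDr u v w : D u -> D v -> D w -> rip w (u + v) = rip w u + rip w v.
Proof.
move=> Du Dv Dw; rewrite ripC ?ripDl//; last exact: domD.
by rewrite (ripC Du Dw) (ripC Dv Dw).
Qed.

Lemma ripZl t u w : D u -> D w -> rip (t%:C *: u) w = t * rip u w.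
Proof. by move=> *; rewrite /rip ipZ// cReM/= mul0r subr0. Qed.

Lemma ripBl u v w : D u -> D v -> D w -> rip (u - v) w = rip u w - rip v w.
Proof.
move=> *; rewrite /rip ipB//.
by case: (<|u, w|>) => a b; case: (<|v, w|>) => c d.
Qed.

Lemma ripBr u v w : D u -> D v -> D w -> rip w (u - v) = rip w u - rip w v.
Proof.
move=> Du Dv Dw; rewrite ripC ?ripBl//; last exact: domB.
by rewrite (ripC Du Dw) (ripC Dv Dw).
Qed.

Lemma sqn_ge0 u : D u -> 0 <= sqn u.
Proof. exact: ip_ge0. Qed.

Lemma sqnD u v : D u -> D v -> sqn (u + v) = sqn u + 2 * rip u v + sqn v.
Proof.
move=> Du Dv; have Duv := domD Du Dv.
by rewrite /sqn ripDl// !ripDr// (ripC Dv Du); ring.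
Qed.

Lemma sqnB u v : D u -> D v -> sqn (u - v) = sqn u - 2 * rip u v + sqn v.
Proof.
move=> Du Dv; have Duv := domB Du Dv.
by rewrite /sqn ripBl// !ripBr// (ripC Dv Du); ring.
Qed.

Lemma sqnZ t u : D u -> sqn (t%:C *: u) = t ^+ 2 * sqn u.
Proof.
move=> Du; have Dtu := domZ t%:C Du.
by rewrite /sqn ripZl// (ripC Du Dtu) ripZl// mulrA.
Qed.

(** The discriminant of [t |-> sqn (u + t v)], which is nonnegative. *)
Lemma cauchy_schwarz u v : D u -> D v -> rip u v ^+ 2 <= sqn u * sqn v.
Proof.
move=> Du Dv.
have H t : 0 <= sqn u + 2 * t * rip u v + t ^+ 2 * sqn v.
  have Dtv := domZ t%:C Dv.
  have := sqn_ge0 (domD Du Dtv).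
  by rewrite sqnD// sqnZ// (ripC Du Dtv) ripZl// (ripC Dv Du) mulrA.
(* If [v] is null, the roles are exchanged: [sqn (v + t u)] is obtained from
   the inequality at the inverse of [t]. *)
have [v0|v0] := eqVneq (sqn v) 0.
  rewrite v0 mulr0.
  suff -> : rip u v = 0 by rewrite expr0n.
  apply: (@quadratic_ge0_linear0 _ (sqn u)) => t.
  have [->|t0] := eqVneq t 0; first by rewrite expr0n /= !mulr0 addr0.
  have := H t^-1; rewrite v0 mulr0 addr0 => /(mulr_ge0 (sqr_ge0 t)).
  congr (_ <= _).
  by field.
have v1 : 0 < sqn v by rewrite lt_neqAle eq_sym v0 sqn_ge0.
have := H (- rip u v / sqn v).
rewrite -(pmulr_lge0 _ v1).
have -> : (sqn u + 2 * (- rip u v / sqn v) * rip u v +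
  (- rip u v / sqn v) ^+ 2 * sqn v) * sqn v = sqn u * sqn v - rip u v ^+ 2.
  by field.
by rewrite subr_ge0.
Qed.

Lemma norm_rip_le u v : D u -> D v ->
  `|rip u v| <= Num.sqrt (sqn u) * Num.sqrt (sqn v).
Proof.
move=> Du Dv; rewrite -sqrtrM ?sqn_ge0// -sqrtr_sqr.
exact/ler_wsqrtr/cauchy_schwarz.
Qed.

(** Cauchy-Schwarz controls the real part only; applied to all the multiples
    [c *: v] it gives the whole product. *)
Lemma ip_eq0_of_null u v : D u -> D v -> sqn u = 0 -> <|u, v|> = 0.
Proof.
move=> Du Dv u0; rewrite ip_conj//.
have -> : <|v, u|> = 0.
  apply: cReM_eq0 => c; have Dcv := domZ c Dv.
  rewrite -ipZ// -/(rip _ _) ripC//; apply/eqP.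
  rewrite -sqrf_eq0 eq_le sqr_ge0 andbT.
  by have := cauchy_schwarz Du Dcv; rewrite u0 mul0r.
by rewrite /= oppr0.
Qed.

(** * Minimal-norm solutions of a moment problem *)

Section Riesz.
Context {X : Type} (phi : X -> V) (Dphi : forall x, D (phi x)).
Implicit Types (s : seq (R[i] * X)) (f : X -> R[i]).

(** Formal combinations are kept as lists of coefficients and indices, so that
    the same combination makes sense for two families with the same index set. *)
Definition comb s : V := \sum_(p <- s) p.1 *: phi p.2.

Definition conj_comb f s : R[i] := \sum_(p <- s) p.1 * conjc (f p.2).

Definition scale_comb c s : seq (R[i] * X) := [seq (c * p.1, p.2) | p <- s].

Lemma dom_comb s : D (comb s).
Proof.
rewrite /comb; elim: s => [|p s ih]; first by rewrite big_nil; exact: dom0.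
by rewrite big_cons; apply: dom_lin.
Qed.

Lemma comb_cat s1 s2 : comb (s1 ++ s2) = comb s1 + comb s2.
Proof. exact: big_cat. Qed.

Lemma comb_scale c s : comb (scale_comb c s) = c *: comb s.
Proof.
by rewrite /comb big_map scaler_sumr; apply: eq_bigr => p _; rewrite scalerA.
Qed.

Lemma conj_comb_cat f s1 s2 :
  conj_comb f (s1 ++ s2) = conj_comb f s1 + conj_comb f s2.
Proof. exact: big_cat. Qed.

Lemma conj_comb_scale f c s :
  conj_comb f (scale_comb c s) = c * conj_comb f s.
Proof.
by rewrite /conj_comb big_map mulr_sumr; apply: eq_bigr => p _; rewrite mulrA.
Qed.

(** As lists can be rescaled, this is the square-root-free form of
    [|conj_comb f s| <= sqrt C * |comb s|]: the functional that [f] prescribes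
    on the span of [phi] is bounded by [sqrt C]. For a given [f] it depends on
    [phi] through the Gram matrix only. *)
Definition sqn_bound f (C : R) : Prop :=
  forall s, 2 * complex.Re (conj_comb f s) <= C + sqn (comb s).

(** The analysis operator of frame theory; the integral operator of the theorem
    is the one of the family of conjugates of the functions [k x]. *)
Definition analysis v : X -> R[i] := fun y => <|v, phi y|>.

Lemma conj_comb_analysis v s : D v -> conj_comb (analysis v) s = <|comb s, v|>.
Proof.
move=> Dv; rewrite /conj_comb; elim: s => [|p s ih].
  by rewrite /comb !big_nil ip0l.
rewrite /comb !big_cons ih ip_lin//; last exact: dom_comb.
by rewrite /analysis -(ip_conj Dv (Dphi _)).
Qed.

(** Expand [0 <= sqn (comb s - v)]. *)
Lemma sqn_bound_analysis v : D v -> sqn_bound (analysis v) (sqn v).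
Proof.
move=> Dv s; have Ds := dom_comb s.
have := sqn_ge0 (domB Ds Dv); rewrite sqnB// conj_comb_analysis// /rip.
lra.
Qed.

Section Minimizer.
Variable f : X -> R[i].

(** The quadratic functional whose minimizer over the closed span of [phi]
    represents [f]; on a solution [v] of [analysis v = f] it is
    [sqn (comb s - v) - sqn v]. *)
Definition energy s : R := sqn (comb s) - 2 * complex.Re (conj_comb f s).

Lemma energy_cat s1 s2 : energy (s1 ++ s2) =
  energy s1 + 2 * rip (comb s1) (comb s2) + energy s2.
Proof.
have D1 := dom_comb s1; have D2 := dom_comb s2.
by rewrite /energy comb_cat conj_comb_cat sqnD// cReD; ring.
Qed.

Lemma energy_scale t s : energy (scale_comb t%:C s) =
  t ^+ 2 * sqn (comb s) - t * (2 * complex.Re (conj_comb f s)).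
Proof.
have Ds := dom_comb s.
rewrite /energy comb_scale conj_comb_scale sqnZ// cReM/= mul0r subr0; ring.
Qed.

(** Parallelogram identity: two almost minimizers are close to each other,
    because their midpoint cannot beat the infimum. *)
Lemma energy_midpoint s1 s2 (I : R) : (forall s, I <= energy s) ->
  sqn (comb s1 - comb s2) <= 2 * (energy s1 - I) + 2 * (energy s2 - I).
Proof.
move=> hI; have D1 := dom_comb s1; have D2 := dom_comb s2.
have := hI (scale_comb (2^-1)%:C (s1 ++ s2)); rewrite energy_scale comb_cat.
rewrite conj_comb_cat cReD sqnD// sqnB// /energy.
lra.
Qed.

(** The Riesz representation theorem, on the closed span of [phi]. A minimizing
    sequence of [energy] is Cauchy by [energy_midpoint]. The first-order
    condition at its limit [b] says that [b] represents [f], and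
    [- sqn b] is the limit of the energies, which are at least [- C] for every
    admissible [C]. Since one [b] serves all bounds [C], it has minimal norm
    among all representations of [f], in this space or in any other one with
    the same Gram matrix. *)
Lemma riesz_min C0 : sqn_bound f C0 ->
  exists2 b, D b &
    analysis b = f /\ forall C, sqn_bound f C -> sqn b <= C.
Proof.
move=> hC0.
pose I := inf (range energy).
have I_inf : has_inf (range energy).
  split; first by exists (energy [::]), [::].
  exists (- C0) => _ [s _ <-]; have := hC0 s; rewrite /energy; lra.
have I_le s : I <= energy s.
  by apply: ge_inf; [exact: I_inf.2|exists s].
have /choice[S S_lt] (n : nat) : exists s, energy s < I + n.+1%:R^-1.
  have n0 : 0 < n.+1%:R^-1 :> R by rewrite invr_gt0.
  by have [_ [s _ <-] ?] := inf_adherent n0 I_inf; exists s.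
pose u n := comb (S n).
have Du n : D (u n) by exact: dom_comb.
have inv_small (e : R) : 0 < e -> exists N : nat, forall n : nat, (N <= n)%N ->
    n.+1%:R^-1 < e.
  move=> e0; exists (Num.truncn e^-1) => n Nn.
  rewrite invf_plt ?posrE//; apply: lt_le_trans (truncnS_gt _) _.
  by rewrite ler_nat ltnS.
have Cu (e : R) : 0 < e -> exists N : nat, forall m n : nat,
    (N <= m)%N -> (N <= n)%N -> Num.sqrt (sqn (u m - u n)) < e.
  move=> e0; have e20 : 0 < e ^+ 2 / 4 by rewrite divr_gt0// exprn_gt0.
  have [N hN] := inv_small _ e20.
  exists N => m n /hN hm /hN hn.
  rewrite -(ltr_pXn2r (n := 2)) ?nnegrE ?sqrtr_ge0 ?(ltW e0)//.
  rewrite sqr_sqrtr ?sqn_ge0//; last exact: domB.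
  have := energy_midpoint (S m) (S n) I_le.
  move: (S_lt m) (S_lt n) hm hn; rewrite -/(u m) -/(u n).
  move: m.+1%:R^-1 n.+1%:R^-1 => p q; lra.
have [b Db u_b] := dom_complete Du Cu.
have dist_small (e : R) : 0 < e -> exists n : nat,
    n.+1%:R^-1 < e /\ Num.sqrt (sqn (u n - b)) < e.
  move=> e0; have [N hN] := inv_small _ e0.
  have /cvgrPdist_lt/(_ _ e0)[M _ hM] := u_b.
  exists (maxn N M); split; first by apply: hN; exact: leq_maxl.
  have := hM _ (leq_maxr N M); rewrite /= sub0r normrN ger0_norm ?sqrtr_ge0//.
(* Compare the energies of [S n] and [S n ++ s] and let [n] grow. *)
have var s : 0 <= sqn (comb s) +
    2 * (rip (comb s) b - complex.Re (conj_comb f s)).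
  have Ds := dom_comb s.
  apply/ler_addgt0Pl => e e0.
  pose K := 1 + 2 * Num.sqrt (sqn (comb s)).
  have K0 : 0 < K by rewrite ltr_wpDr// mulr_ge0// sqrtr_ge0.
  have eK0 : 0 < e / K by rewrite divr_gt0.
  have [n [n1 n2]] := dist_small _ eK0.
  have := I_le (S n ++ s); rewrite energy_cat {2}/energy.
  have := S_lt n.
  have Dub : D (u n - b) by exact: domB.
  have := norm_rip_le Ds Dub; rewrite ripBr// (ripC Ds (Du n)).
  rewrite -/(u n); move=> h1 h2 h3.
  have {}h1 := le_trans (ler_norm _) h1.
  have eE : e = e / K + 2 * (Num.sqrt (sqn (comb s)) * (e / K)).
    rewrite /K; field; exact: lt0r_neq0.
  have : Num.sqrt (sqn (comb s)) * Num.sqrt (sqn (u n - b)) <=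
         Num.sqrt (sqn (comb s)) * (e / K).
    by apply: ler_wpM2l; [exact: sqrtr_ge0|exact: ltW].
  move: n1 h1 h2 h3 eE.
  move: (Num.sqrt (sqn (comb s)) * Num.sqrt (sqn (u n - b))).
  move: (Num.sqrt (sqn (comb s)) * (e / K)) (e / K) (n.+1%:R^-1).
  move=> p1 p2 p3 p4; lra.
(* [var] at the multiples of [s]: the linear term in the factor vanishes. *)
have rep s : rip (comb s) b = complex.Re (conj_comb f s).
  apply/eqP; rewrite -subr_eq0; apply/eqP.
  apply: (@quadratic_ge0_linear0 _ (sqn (comb s))) => t.
  have Ds := dom_comb s.
  have := var (scale_comb t%:C s).
  rewrite comb_scale sqnZ// ripZl// conj_comb_scale cReM/= mul0r subr0.
  congr (_ <= _); ring.
exists b => //; split.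
  apply/funext => y; rewrite /analysis ip_conj//.
  apply/eqP; rewrite -subr_eq0; apply/eqP.
  rewrite -[f y]conj_involutive -conjcB.
  suff -> : <|phi y, b|> - conjc (f y) = 0 by rewrite /= oppr0.
  apply: cReM_eq0 => c; rewrite mulrBr -ipZ//.
  have := rep [:: (c, y)]; rewrite /comb /conj_comb !big_seq1/= /rip => h.
  by rewrite cReD h; case: (c * _) => p q /=; rewrite subrr.
move=> C hC; apply/ler_addgt0Pl => e e0.
have e0' : 0 < Num.sqrt e by rewrite sqrtr_gt0.
have [n [_ n2]] := dist_small _ e0'.
have := hC (S n); rewrite -rep.
have : sqn (u n - b) < e.
  by move: n2; rewrite ltr_sqrt.
rewrite sqnB// -/(u n); lra.
Qed.

End Minimizer.
End Riesz.
End SemiHilbertTheory.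

(** * Comparison of two spaces with the same Gram matrix *)

Section Transfer.
Context {R : realType} {V W : lmodType R[i]}.
Variables (E : semi_hilbert V) (F : semi_hilbert W).
Context {X : Type}.
Variables (phi : X -> V) (psi : X -> W).
Hypotheses (Dphi : forall x, dom E (phi x)) (Dpsi : forall x, dom F (psi x)).
Hypothesis same_gram : forall x y, ip E (phi x) (phi y) = ip F (psi x) (psi y).

Lemma sqn_comb_gram s : sqn E (comb phi s) = sqn F (comb psi s).
Proof.
have H y t : ip E (comb phi t) (phi y) = ip F (comb psi t) (psi y).
  rewrite /comb; elim: t => [|p t ih]; first by rewrite !big_nil !ip0l.
  by rewrite !big_cons !ip_lin// ?ih ?same_gram//; apply: dom_comb.
rewrite /sqn /rip -!conj_comb_analysis//; try exact: dom_comb.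
by congr (complex.Re (conj_comb _ _)); apply/funext => y; exact: H.
Qed.

Lemma sqn_bound_gram f C : sqn_bound E phi f C -> sqn_bound F psi f C.
Proof. by move=> h s; rewrite -sqn_comb_gram. Qed.

(** The bound [sqn_bound] passes from [E] to [F] through the common Gram matrix,
    and [riesz_min] turns it back into a vector of [F]. *)
Lemma analysis_transfer v : dom E v ->
  exists2 w, dom F w &
    analysis F psi w = analysis E phi v /\ sqn F w <= sqn E v.
Proof.
move=> Dv; have hv := sqn_bound_gram (sqn_bound_analysis Dphi Dv).
have [w Dw [ew minw]] := riesz_min Dpsi hv.
by exists w => //; split => //; exact: minw.
Qed.

End Transfer.

(** * The range of an analysis operator as a reproducing kernel Hilbert space *)

Section RangeRKHS.
Context {R : realType} {V : lmodType R[i]} (E : semi_hilbert V).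
Context {X : Type} (phi : X -> V) (Dphi : forall x, dom E (phi x)).
Local Notation D := (dom E).
Local Notation S := (analysis E phi).

Definition range_carrier : set (X -> R[i]) := [set S v | v in D].

Lemma analysis_lin c u v : D u -> D v -> S (c *: u + v) = c *: S u + S v.
Proof. by move=> Du Dv; apply/funext => y; rewrite /analysis ip_lin. Qed.

Lemma analysisB u v : D u -> D v -> S (u - v) = S u - S v.
Proof.
by move=> Du Dv; rewrite addrC -scaleN1r analysis_lin// scaleN1r addrC.
Qed.

(** On these vectors the analysis operator is injective up to null vectors;
    they form the orthogonal complement of its kernel, on which the norm of
    the range is read off. *)
Definition orth_ker v := forall n, D n -> S n = 0 -> ip E v n = 0.

Lemma orth_ker_lin c u v : D u -> D v ->
  orth_ker u -> orth_ker v -> orth_ker (c *: u + v).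
Proof.
move=> Du Dv hu hv n Dn Sn; rewrite ip_lin// hu// hv//.
by rewrite mulr0 addr0.
Qed.

(** This is what makes [range_inner] linear, although [min_rep] is a choice:
    an inner product with a vector orthogonal to the kernel depends only on the
    image under [S] of the other argument. *)
Lemma ip_ker_eqr h u v : D h -> D u -> D v -> orth_ker h -> S u = S v ->
  ip E h u = ip E h v.
Proof.
move=> Dh Du Dv oh e; apply/eqP; rewrite -subr_eq0; apply/eqP.
have Duv := domB Du Dv.
have := oh _ Duv; rewrite analysisB// e subrr => /(_ erefl).
rewrite (ip_conj Duv Dh) ipB// conjcB -!ip_conj//.
Qed.

(** Pythagoras: [v - u] lies in the kernel, hence is orthogonal to [u]. *)
Lemma orth_ker_min u v : D u -> D v -> orth_ker u -> S u = S v ->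
  sqn E u <= sqn E v.
Proof.
move=> Du Dv ou e; have Duv := domB Dv Du.
have := sqn_ge0 Duv; rewrite sqnB//.
have := ip_ker_eqr Du Dv Du ou (esym e); rewrite -(@ripC _ _ E u v)//.
by rewrite /sqn /rip => ->; lra.
Qed.

(** The solution given by [riesz_min] has minimal norm among all [u + t n] with
    [n] in the kernel, hence is orthogonal to the kernel. *)
Lemma exists_orth_ker v : D v -> exists2 u, D u & S u = S v /\ orth_ker u.
Proof.
move=> Dv; have [u Du [Su minu]] := riesz_min Dphi (sqn_bound_analysis Dphi Dv).
exists u => //; split => // n Dn Sn.
rewrite ip_conj//; suff -> : ip E n u = 0 by rewrite /= oppr0.
(* Complex multiples of [n] are in the kernel too, so that real parts suffice. *)
apply: cReM_eq0 => c; rewrite -ipZ//.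
have Dcn := domZ c Dn.
apply: (@quadratic_ge0_linear0 _ (sqn E (c *: n))) => t.
have Dt := domZ t%:C Dcn.
have Dut := domD Du Dt.
have Sut : S (u + t%:C *: (c *: n)) = S v.
  by rewrite addrC scalerA analysis_lin// Sn scaler0 add0r.
have := minu (sqn E (u + t%:C *: (c *: n))).
rewrite -{1}Sut => /(_ (sqn_bound_analysis Dphi Dut)).
rewrite sqnD// sqnZ// (ripC Du Dt) ripZl// /rip; lra.
Qed.

Definition min_rep (f : X -> R[i]) : V :=
  xget 0 [set u | [/\ D u, S u = f & orth_ker u]].

Lemma min_repP f : range_carrier f ->
  [/\ D (min_rep f), S (min_rep f) = f & orth_ker (min_rep f)].
Proof.
move=> [v Dv <-]; have [u Du [Su ou]] := exists_orth_ker Dv.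
by apply: (@xgetPex _ 0 [set u | [/\ D u, S u = S v & orth_ker u]]); exists u.
Qed.

Definition range_inner (f g : X -> R[i]) : R[i] := ip E (min_rep f) (min_rep g).

Lemma range_inner_rep a f g : D a -> S a = f -> range_carrier g ->
  range_inner f g = ip E a (min_rep g).
Proof.
move=> Da Sa gc; have fc : range_carrier f by exists a.
have [Df Sf of_] := min_repP fc; have [Dg Sg og] := min_repP gc.
rewrite /range_inner (ip_conj Dg Df) (ip_conj Dg Da).
by rewrite (ip_ker_eqr Dg Df Da og)// Sf.
Qed.

Lemma range_submod : submod_closed [in range_carrier].
Proof.
split; first by apply/mem_set; exists 0; [exact: dom0|apply/funext => y; rewrite /analysis ip0l].
move=> c f g /set_mem[u Du <-] /set_mem[v Dv <-]; apply/mem_set.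
by exists (c *: u + v); [exact: dom_lin|exact: analysis_lin].
Qed.

Lemma range_inner_linear c f g h :
  range_carrier f -> range_carrier g -> range_carrier h ->
  range_inner (c *: f + g) h = c * range_inner f h + range_inner g h.
Proof.
move=> fc gc hc; have [Df Sf _] := min_repP fc; have [Dg Sg _] := min_repP gc.
have [Dh _ _] := min_repP hc.
rewrite (@range_inner_rep (c *: min_rep f + min_rep g))//; first by rewrite ip_lin.
  exact: dom_lin.
by rewrite analysis_lin// Sf Sg.
Qed.

Lemma range_inner_conj f g : range_carrier f -> range_carrier g ->
  range_inner g f = (range_inner f g)^*.
Proof.
by move=> fc gc; apply: ip_conj; [have [] := min_repP fc|have [] := min_repP gc].
Qed.

Lemma range_inner_pos f : range_carrier f -> f != 0 -> 0 < range_inner f f.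
Proof.
move=> fc f0; have [Df Sf _] := min_repP fc.
rewrite /range_inner; set v := min_rep f.
have : complex.Im (ip E v v) = 0.
  have := ip_conj Df Df; rewrite -/v; case: (ip E v v) => a b [] /=; lra.
have : 0 < complex.Re (ip E v v).
  rewrite lt_neqAle ip_ge0// andbT eq_sym; apply: contra f0 => /eqP v0.
  apply/eqP; rewrite -Sf; apply/funext => y.
  exact: ip_eq0_of_null.
by case: (ip E v v) => a b /= a0 ->; rewrite ltcE/= eqxx.
Qed.

Lemma range_sqn_le a f : D a -> S a = f ->
  complex.Re (range_inner f f) <= sqn E a.
Proof.
move=> Da Sa; have fc : range_carrier f by exists a.
have [Df Sf of_] := min_repP fc.
by apply: orth_ker_min; rewrite ?Sa.
Qed.

(** Differences of minimal representatives are orthogonal to the kernel, hence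
    no longer than any other representative of the difference: a Cauchy
    sequence of functions lifts to a Cauchy sequence of vectors. The image of
    the limit of the lift is the limit in the range, by [range_sqn_le]. *)
Lemma range_complete (u : nat -> X -> R[i]) : (forall n, range_carrier (u n)) ->
  (forall e : R, 0 < e -> exists N : nat, forall m n : nat,
     (N <= m)%N -> (N <= n)%N ->
     norm_of_inner range_inner (u m - u n) < e) ->
  exists2 f : X -> R[i], range_carrier f &
    (fun n : nat => norm_of_inner range_inner (u n - f)) @ \oo --> (0 : R).
Proof.
move=> uc Cu; pose a n := min_rep (u n).
have aP n : [/\ D (a n), S (a n) = u n & orth_ker (a n)] by exact: min_repP.
have Da n : D (a n) by have [] := aP n.
have Sa n : S (a n) = u n by have [] := aP n.
have [e e0|b Db a_b] := @dom_complete _ _ E a Da.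
  have [N hN] := Cu _ e0; exists N => m n Nm Nn.
  apply: le_lt_trans (hN m n Nm Nn); apply: ler_wsqrtr.
  have Dmn := domB (Da m) (Da n).
  have umn : range_carrier (u m - u n).
    by exists (a m - a n) => //; rewrite analysisB// !Sa.
  have [Df Sf _] := min_repP umn.
  apply: orth_ker_min => //; last by rewrite analysisB// !Sa Sf.
  rewrite addrC -scaleN1r; apply: orth_ker_lin => //.
    by have [] := aP n.
  by have [] := aP m.
exists (S b); first by exists b.
apply/cvgrPdist_lt => e e0.
move/cvgrPdist_lt : a_b => /(_ _ e0) [N _ hN]; exists N => // n Nn.
have := hN n Nn; rewrite /= !sub0r !normrN !ger0_norm ?sqrtr_ge0//.
apply: le_lt_trans; apply: ler_wsqrtr; apply: range_sqn_le; first exact: domB.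
by rewrite analysisB// Sa.
Qed.

Definition range_space : hilbert_fun_space R X :=
  HilbertFunSpace range_submod range_inner_linear range_inner_conj
    range_inner_pos range_complete.

(** The function [K(., y)] is [S (phi y)], and an inner product with
    [min_rep f] does not see the difference between [phi y] and the chosen
    representative. *)
Lemma range_space_is_rkhs : is_rkhs (fun x y => ip E (phi y) (phi x)) range_space.
Proof.
have kc y : range_carrier (fun x => ip E (phi y) (phi x)) by exists (phi y).
split=> //= f y fc; have [Df Sf of_] := min_repP fc.
rewrite /range_inner; have [Dk Sk _] := min_repP (kc y).
rewrite (ip_ker_eqr Df Dk (Dphi y) of_); first by rewrite -{1}Sf.
by rewrite Sk.
Qed.

End RangeRKHS.

(** * Uniqueness and the norm formula *)

Section HilbertFunSpaceAsSemiHilbert.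
Context {R : realType} {X : Type} (H : hilbert_fun_space R X).

Lemma carrier0 : carrier H 0.
Proof. by have [/set_mem] := carrier_submod H. Qed.

Lemma carrier_lin (c : R[i]) f g :
  carrier H f -> carrier H g -> carrier H (c *: f + g).
Proof.
have [_ h] := carrier_submod H; move=> fc gc.
by apply/set_mem/h; exact: mem_set.
Qed.

Lemma inner_ge0 f : carrier H f -> 0 <= complex.Re (inner H f f).
Proof.
move=> fc; have [->|f0] := eqVneq f 0.
  have := inner_linear 1 carrier0 carrier0 carrier0.
  rewrite scaler0 addr0 mul1r => /(congr1 (@complex.Re R)); rewrite cReD; lra.
by have := inner_pos fc f0; case: (inner H f f) => a b; rewrite ltcE/= => /andP[_ /ltW].
Qed.

Definition semi_hilbert_of_space : semi_hilbert (X -> R[i]) :=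
  SemiHilbert carrier0 carrier_lin (@inner_linear _ _ H) (@inner_conj _ _ H)
    inner_ge0 (@carrier_complete _ _ H).

End HilbertFunSpaceAsSemiHilbert.

Section Uniqueness.
Context {R : realType} {V : lmodType R[i]} (E : semi_hilbert V).
Context {X : Type} (phi : X -> V) (Dphi : forall x, dom E (phi x)).

(** The functions [K(., y)] in [H] have the same Gram matrix as [phi], and
    their analysis operator is the identity of [H], by the reproducing
    property. So [analysis_transfer] from [E] to [H] puts the range inside [H]
    without increasing norms, and the transfer from [H] to [E] gives each
    function of [H] a preimage that attains the infimum. *)
Lemma rkhs_range (H : hilbert_fun_space R X) :
  is_rkhs (fun x y => ip E (phi y) (phi x)) H ->
  carrier H = range_carrier E phi /\
  forall f, carrier H f ->
    hnorm H f = inf [set Num.sqrt (sqn E a) | a in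
      [set a | dom E a /\ analysis E phi a = f]].
Proof.
move=> [Kc rep].
pose F := semi_hilbert_of_space H.
pose psi (y x : X) : R[i] := ip E (phi y) (phi x).
have gram x y : ip E (phi x) (phi y) = ip F (psi x) (psi y).
  exact: (rep (psi x) y (Kc x)).
have gram' x y : ip F (psi x) (psi y) = ip E (phi x) (phi y) by rewrite gram.
have analysisF f : carrier H f -> analysis F psi f = f.
  by move=> fc; apply/funext => y; rewrite [RHS]rep.
have toF a : dom E a -> carrier H (analysis E phi a) /\
    sqn F (analysis E phi a) <= sqn E a.
  move=> Da.
  have [f fc []] := @analysis_transfer _ _ _ E F _ phi psi Dphi Kc gram a Da.
  by rewrite analysisF// => <-.
have toE f : carrier H f -> exists2 a, dom E a &
    analysis E phi a = f /\ sqn E a <= sqn F f.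
  move=> fc.
  have [a Da []] := @analysis_transfer _ _ _ F E _ psi phi Kc Dphi gram' f fc.
  by rewrite analysisF//; exists a.
split.
  apply/seteqP; split=> [f fc|f [a Da <-]]; last by have [] := toF a Da.
  by have [a Da [<- _]] := toE f fc; exists a.
move=> f fc; have [a Da [Sa le_af]] := toE f fc.
set A := [set _ | _ in _].
have lbA : lbound A (hnorm H f).
  move=> _ [b [Db Sb] <-]; apply: ler_wsqrtr; rewrite -Sb.
  by have [] := toF b Db.
have Aa : A (Num.sqrt (sqn E a)) by exists a.
apply/eqP; rewrite eq_le; apply/andP; split.
  by apply: lb_le_inf => //; exists (Num.sqrt (sqn E a)).
apply: le_trans (_ : Num.sqrt (sqn E a) <= _).
  by apply: ge_inf => //; exists (hnorm H f).
exact: ler_wsqrtr.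
Qed.

End Uniqueness.

(** * Completeness of real [L_2] *)

Section RealL2Complete.
Context {R : realType} {d : measure_display} {T : measurableType d}.
Variable mu : {measure set T -> \bar R}.

Definition sqdist (f g : T -> R) : \bar R :=
  (\int[mu]_x ((f x - g x) ^+ 2)%:E)%E.

Lemma measurable_sqdiff (f g : T -> R) (A : set T) :
  measurable_fun setT f -> measurable_fun setT g ->
  measurable_fun A (fun x => ((f x - g x) ^+ 2)%:E : \bar R).
Proof.
move=> mf mg; apply: (@measurable_funS _ _ _ _ setT) => //.
by apply/measurable_EFinP/measurable_funX; exact: measurable_funB.
Qed.

(** Each term of the sum is at most the sum, so the increments of [a] decay like
    [2 ^- k]. Working with weighted squares, whose integrals are known,
    avoids the triangle inequality in [L_2]. *)
Lemma weighted_sqr_lty_cvg (a : nat -> R) :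
  (\sum_(0 <= k <oo) (4 ^+ k * (a k.+1 - a k) ^+ 2)%:E < +oo)%E -> cvgn a.
Proof.
move=> fin; set s := (\sum_(0 <= k <oo) _)%E in fin.
have term_ge0 k : (0 <= (4 ^+ k * (a k.+1 - a k) ^+ 2)%:E :> \bar R)%E.
  by rewrite lee_fin mulr_ge0 ?sqr_ge0// exprn_ge0.
have s0 : (0 <= s)%E by apply: nneseries_ge0 => k _ _; exact: term_ge0.
have sfin : s \is a fin_num by rewrite ge0_fin_numE.
pose M := Num.sqrt (fine s).
have bound k : `|a k.+1 - a k| <= geometric M 2^-1 k.
  have h : 4 ^+ k * (a k.+1 - a k) ^+ 2 <= fine s.
    rewrite -lee_fin fineK//.
    have := @nneseries_lim_ge R (fun k => (4 ^+ k * (a k.+1 - a k) ^+ 2)%:E) xpredT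
      0 k.+1 (fun n _ _ => term_ge0 n).
    apply: le_trans; rewrite big_nat_recr//= leeDr//.
    by apply: sume_ge0 => i _; exact: term_ge0.
  rewrite /= -sqrtr_sqr exprVn ler_pdivlMr ?exprn_gt0//.
  rewrite -[2 ^+ k]ger0_norm ?exprn_ge0// -sqrtr_sqr -sqrtrM ?sqr_ge0//.
  by apply: ler_wsqrtr; rewrite -exprM mulnC exprM mulrC -natrX.
have cv : cvgn (series (fun k => a k.+1 - a k)).
  apply: normed_cvg; apply: (@series_le_cvg _ _ (geometric M 2^-1)).
  - by move=> k; exact: normr_ge0.
  - by move=> k; rewrite /= mulr_ge0 ?sqrtr_ge0// exprn_ge0.
  - exact: bound.
  by apply: is_cvg_geometric_series; rewrite ger0_norm// invf_lt1// ltr1n.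
have -> : a = (fun n => a 0%N + series (fun k => a k.+1 - a k) n).
  apply/funext => n; rewrite /series/= telescope_sumr// addrC subrK//.
exact: is_cvgD (is_cvg_cst _) cv.
Qed.

Lemma fast_subsequence (f : nat -> T -> R) :
  (forall e : R, 0 < e -> exists N : nat, forall m n : nat,
    (N <= m)%N -> (N <= n)%N -> (sqdist (f m) (f n) < e%:E)%E) ->
  forall e : nat -> R, (forall k, 0 < e k) -> exists phi : nat -> nat,
    (forall k, (k <= phi k)%N) /\
    forall k, (sqdist (f (phi k.+1)) (f (phi k)) < (e k)%:E)%E.
Proof.
move=> Cf e e0.
have /choice[N hN] (k : nat) : exists N : nat, forall m n : nat,
  (N <= m)%N -> (N <= n)%N -> (sqdist (f m) (f n) < (e k)%:E)%E by exact: Cf.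
(* The sum grows with [k] and dominates its last term, so that both indices
   [phi k] and [phi k.+1] are past [N k]. *)
exists (fun k => k + \sum_(i < k.+1) N i)%N; split=> [k|k]; first exact: leq_addr.
by apply: hN; rewrite !big_ord_recr/=; lia.
Qed.

(** Riesz-Fischer. Along a fast subsequence the integral of the weighted sum of
    the squared increments is finite, hence the sum is finite almost
    everywhere and the subsequence converges there. Fatou's lemma then bounds
    the distance to the pointwise limit. *)
Lemma sqdist_complete (f : nat -> T -> R) :
  (forall n, measurable_fun setT (f n)) ->
  (forall e : R, 0 < e -> exists N : nat, forall m n : nat,
    (N <= m)%N -> (N <= n)%N -> (sqdist (f m) (f n) < e%:E)%E) ->
  exists2 g : T -> R, measurable_fun setT g &
    forall e : R, 0 < e -> exists N : nat, forall n : nat,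
      (N <= n)%N -> (sqdist (f n) g <= e%:E)%E.
Proof.
move=> mf Cf.
(* The weight [4 ^+ k] leaves integrals at most [2 ^- k.+1], with sum 1. *)
have e0 k : 0 < (4 ^+ k)^-1 * (1 / (2 ^ k.+1)%:R) :> R.
  by rewrite mulr_gt0 ?invr_gt0 ?exprn_gt0// div1r invr_gt0 ltr0n expn_gt0.
have [phi [phi_ge phi_lt]] := fast_subsequence Cf e0.
pose h k x := (4 ^+ k * (f (phi k.+1) x - f (phi k) x) ^+ 2)%:E : \bar R.
have h0 k x : (0 <= h k x)%E.
  by rewrite lee_fin mulr_ge0 ?sqr_ge0// exprn_ge0.
have mh k : measurable_fun setT (h k).
  apply/measurable_EFinP/measurable_funM => //.
  exact/measurable_funX/measurable_funB.
pose F x := (\sum_(0 <= k <oo) h k x)%E.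
have mF : measurable_fun setT F.
  by have := @ge0_emeasurable_sum _ _ _ setT h xpredT (fun k x _ _ => h0 k x)
    (fun k _ => mh k).
have intF : (\int[mu]_x F x < +oo)%E.
  rewrite integral_nneseries//.
  apply: le_lt_trans (ltry 1).
  apply: le_trans (@epsilon_trick0 R 1 xpredT ler01).
  apply: lee_nneseries => [k _ _|k _]; first exact: integral_ge0.
  under eq_integral do rewrite /h EFinM.
  rewrite ge0_integralZl//; last 2 first.
  - exact: measurable_sqdiff.
  - by move=> x _; rewrite lee_fin sqr_ge0.
  rewrite -lee_pdivlMl ?exprn_gt0// -EFinM.
  exact/ltW/phi_lt.
have F0 x : (0 <= F x)%E by apply: nneseries_ge0 => k _ _; exact: h0.
pose A := [set x | (F x < +oo)%E].
have mA : measurable A.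
  by rewrite -[A]setTI; exact: emeasurable_fun_infty_o.
have muA : mu (~` A) = 0%E.
  have : mu.-integrable setT F.
    apply/integrableP; split => //.
    by under eq_integral do rewrite gee0_abs//.
  move/(integrable_ae measurableT) => [B [mB B0 sB]].
  apply: (subset_measure0 (measurableC mA) mB) => // x nAx.
  apply: sB => /= /(_ I); rewrite ge0_fin_numE// => /nAx //.
have cvA x : A x -> cvgn (fun k => f (phi k) x).
  exact: weighted_sqr_lty_cvg.
(* Cutting off by the indicator of [A] makes the convergence hold everywhere,
   which gives the measurability of the limit. *)
pose g x := limn (fun k => f (phi k) x * \1_A x).
have g_cv x : f (phi k) x * \1_A x @[k --> \oo] --> g x.
  have [Ax|nAx] := pselect (A x).
    rewrite /g indicE mem_set//=.
    by under eq_fun do rewrite mulr1; exact: cvA.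
  rewrite /g indicE memNset//=.
  under eq_fun do rewrite mulr0.
  exact: is_cvg_cst.
have g_cvA x : A x -> f (phi k) x @[k --> \oo] --> g x.
  move=> Ax; have := g_cv x; rewrite indicE mem_set//=.
  by under eq_fun do rewrite mulr1.
have mg : measurable_fun setT g.
  apply: (@measurable_fun_cvg _ _ _ _ (fun k x => f (phi k) x * \1_A x)) => // k.
  by apply: measurable_funM => //; exact: measurable_indic.
exists g => // e e_gt0; have [N hN] := Cf _ e_gt0; exists N => n Nn.
rewrite /sqdist (@ge0_negligible_integral _ _ _ _ _ (~` A))//; last 3 first.
- exact: measurableC.
- exact: measurable_sqdiff.
- by move=> x _; rewrite lee_fin sqr_ge0.
rewrite setTD setCK.
pose G k x := ((f n x - f (phi k) x) ^+ 2)%:E : \bar R.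
have -> : (\int[mu]_(x in A) ((f n x - g x) ^+ 2)%:E)%E =
    (\int[mu]_(x in A) limn_einf (G ^~ x))%E.
  apply: eq_integral => x /set_mem Ax; apply/esym.
  have /cvg_limn_einf_sup[] // : G ^~ x @ \oo --> ((f n x - g x) ^+ 2)%:E.
  apply: cvg_EFin; first by near=> k.
  have dcv : f n x - f (phi k) x @[k --> \oo] --> f n x - g x.
    by apply: cvgB; [exact: cvg_cst|exact: g_cvA].
  exact: (cvgM dcv dcv).
apply: le_trans (@fatou _ _ _ mu A mA G _ _) _.
- by move=> k; exact: measurable_sqdiff.
- by move=> k x _; rewrite lee_fin sqr_ge0.
rewrite limn_einf_lim.
apply: lime_le; first exact: is_cvg_einfs.
(* The infimum of the tail from [m] is bounded by the term at [maxn m N], which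
   is past [N]. *)
near=> m; apply: ereal_inf_le.
exists (\int[mu]_(x in A) G (maxn m N) x)%E.
  by exists (maxn m N) => //=; rewrite leq_max leqnn.
apply: (@le_trans _ _ (sqdist (f n) (f (phi (maxn m N))))).
  apply: ge0_subset_integral => //; first exact: measurable_sqdiff.
  by move=> x _; rewrite lee_fin sqr_ge0.
apply/ltW/hN => //; apply: leq_trans (phi_ge _).
exact: leq_maxr.
Unshelve. all: by end_near. Qed.

End RealL2Complete.

(** * Complex [L_2] as a complete semi-inner product space *)

Section SquareIntegrable.
Context {R : realType} {d : measure_display} {T : measurableType d}.
Variable mu : {measure set T -> \bar R}.
Local Notation integrable := (mu.-integrable setT).

Definition sqint (f : T -> R) : Prop :=
  measurable_fun setT f /\ (\int[mu]_x (f x ^+ 2)%:E < +oo)%E.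

Lemma sqint_integrable_sqr f : sqint f -> integrable (EFin \o (fun x => f x ^+ 2)).
Proof.
move=> [mf f2]; apply/integrableP; split.
  by apply/measurable_EFinP/measurable_funX.
by under eq_integral do rewrite /= ger0_norm ?sqr_ge0//.
Qed.

Lemma sqint_integrable_mul f g : sqint f -> sqint g ->
  integrable (EFin \o (fun x => f x * g x)).
Proof.
move=> hf hg.
have := integrableD measurableT (sqint_integrable_sqr hf) (sqint_integrable_sqr hg).
apply: le_integrable => //.
  by apply/measurable_EFinP/measurable_funM; [exact: hf.1|exact: hg.1].
move=> x _ /=; rewrite lee_fin [leRHS]ger0_norm ?addr_ge0 ?sqr_ge0//.
by rewrite ler_norml; apply/andP; split; nra.
Qed.

Lemma integrableDM (a b : R) f g :
  integrable (EFin \o f) -> integrable (EFin \o g) ->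
  integrable (EFin \o (fun x => a * f x + b * g x)).
Proof.
move=> hf hg.
exact: (integrableD measurableT (integrableZl measurableT a hf)
  (integrableZl measurableT b hg)).
Qed.

Lemma RintegralDM (a b : R) f g :
  integrable (EFin \o f) -> integrable (EFin \o g) ->
  Rintegral mu setT (fun x => a * f x + b * g x) =
  a * Rintegral mu setT f + b * Rintegral mu setT g.
Proof.
move=> hf hg; rewrite RintegralD//; last 2 first.
- exact: (integrableZl measurableT a hf).
- exact: (integrableZl measurableT b hg).
by rewrite !RintegralZl.
Qed.

Lemma sqintDM (a b : R) f g : sqint f -> sqint g ->
  sqint (fun x => a * f x + b * g x).
Proof.
move=> hf hg; split.
  by apply: measurable_funD; apply: measurable_funM => //; [exact: hf.1|exact: hg.1].
have h1 := integrableDM (a ^+ 2) (b ^+ 2)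
  (sqint_integrable_sqr hf) (sqint_integrable_sqr hg).
have h2 := integrableDM 1 (2 * a * b) h1 (sqint_integrable_mul hf hg).
have /integrableP[_] := h2.
congr (_ < _)%E; apply: eq_integral => x _ /=; congr EFin.
rewrite ger0_norm; first by ring.
have -> : 1 * (a ^+ 2 * f x ^+ 2 + b ^+ 2 * g x ^+ 2) + 2 * a * b * (f x * g x) =
  (a * f x + b * g x) ^+ 2 by ring.
exact: sqr_ge0.
Qed.

Lemma sqint0 : sqint (fun=> 0).
Proof.
split; first exact: measurable_cst.
by under eq_integral do rewrite expr0n/=; rewrite integral0.
Qed.

End SquareIntegrable.

Section ComplexL2.
Context {R : realType} {d : measure_display} {T : measurableType d}.
Variable mu : {measure set T -> \bar R}.
Implicit Types (f g : T -> R[i]).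
Local Notation integrable := (mu.-integrable setT).

Definition cintegrable f : Prop :=
  integrable (EFin \o (fun w => complex.Re (f w))) /\
  integrable (EFin \o (fun w => complex.Im (f w))).

Lemma cintegral_lin (c : R[i]) f g : cintegrable f -> cintegrable g ->
  cintegral mu (fun w => c * f w + g w) = c * cintegral mu f + cintegral mu g.
Proof.
move=> [rf jf] [rg jg]; case: c => a b.
have h1 := integrableDM a (- b) rf jf.
have h2 := integrableDM a b jf rf.
have := RintegralDM 1 1 h1 rg; rewrite [X in 1 * X + _]RintegralDM// !mul1r => e1.
have := RintegralDM 1 1 h2 jg; rewrite [X in 1 * X + _]RintegralDM// !mul1r => e2.
apply: complex_ext; rewrite ?cReD ?cImD ?cReM ?cImM/=.
  rewrite -mulNr -e1; apply: eq_Rintegral => x _.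
  by rewrite cReD cReM/=; ring.
rewrite -e2; apply: eq_Rintegral => x _.
by rewrite cImD cImM/=; ring.
Qed.

Lemma cintegral_conj f : cintegrable f ->
  cintegral mu (fun w => conjc (f w)) = conjc (cintegral mu f).
Proof.
move=> [rf jf]; apply: complex_ext; rewrite ?cRe_conjc ?cIm_conjc/=.
  by apply: eq_Rintegral => x _; rewrite cRe_conjc.
rewrite -mulN1r -RintegralZl//; apply: eq_Rintegral => x _.
by rewrite cIm_conjc mulN1r.
Qed.

Definition csqr (z : R[i]) : R := complex.Re z ^+ 2 + complex.Im z ^+ 2.

Lemma csqr_ge0 z : 0 <= csqr z.
Proof. by rewrite addr_ge0 ?sqr_ge0. Qed.

Lemma cL2enormE f : cL2enorm mu f = ((\int[mu]_w (csqr (f w))%:E) `^ 2^-1)%E.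
Proof.
rewrite /cL2enorm unlock; congr (_ `^ _)%E; apply: eq_integral => w _.
rewrite abse_EFin poweR_EFin; congr EFin.
rewrite powR_mulrn// /csqr.
case: (f w) => a b /=; rewrite real_normK ?num_real// sqr_sqrtr//.
by rewrite addr_ge0 ?sqr_ge0.
Qed.

Lemma integral_csqrD f : cmeasurable f ->
  (\int[mu]_w (csqr (f w))%:E = \int[mu]_w (complex.Re (f w) ^+ 2)%:E +
    \int[mu]_w (complex.Im (f w) ^+ 2)%:E)%E.
Proof.
move=> [mr mi]; under eq_integral do rewrite /csqr EFinD.
rewrite ge0_integralD//; try by move=> *; rewrite lee_fin sqr_ge0.
  by apply/measurable_EFinP/measurable_funX.
by apply/measurable_EFinP/measurable_funX.
Qed.

(** Reduces membership, products and completeness to the real case. *)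
Lemma cL2P f : cL2 mu f <->
  sqint mu (fun w => complex.Re (f w)) /\ sqint mu (fun w => complex.Im (f w)).
Proof.
have ge0 (h : T -> R) : (0 <= \int[mu]_w (h w ^+ 2)%:E)%E.
  by apply: integral_ge0 => w _; rewrite lee_fin sqr_ge0.
split=> [[mf]|[[mr r2] [mi i2]]].
  rewrite cL2enormE => /lty_poweRy; rewrite invr_eq0 pnatr_eq0 => /(_ isT).
  rewrite integral_csqrD// => h; case: mf => mr mi.
  by split; split => //; apply: le_lt_trans h; rewrite ?leeDl ?leeDr.
split; first by split.
by rewrite cL2enormE poweR_lty// integral_csqrD// lte_add_pinfty.
Qed.

Definition L2ip f g : R[i] := cintegral mu (fun w => f w * conjc (g w)).

Lemma cintegrable_mul f g : cL2 mu f -> cL2 mu g ->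
  cintegrable (fun w => f w * g w).
Proof.
move=> /cL2P[rf jf] /cL2P[rg jg]; split.
  have := integrableDM 1 (-1) (sqint_integrable_mul rf rg) (sqint_integrable_mul jf jg).
  congr (mu.-integrable _ _); apply/funext => x /=.
  by rewrite cReM mul1r mulN1r.
have := integrableDM 1 1 (sqint_integrable_mul rf jg) (sqint_integrable_mul jf rg).
congr (mu.-integrable _ _); apply/funext => x /=.
by rewrite cImM !mul1r.
Qed.

Lemma cL2_conj f : cL2 mu f -> cL2 mu (fun w => conjc (f w)).
Proof.
move=> /cL2P[rf jf]; apply/cL2P; split.
  by under eq_fun do rewrite cRe_conjc.
have := sqintDM (-1) 0 jf jf; congr sqint; apply/funext => w.
by rewrite cIm_conjc; ring.
Qed.

Lemma cL2_0 : cL2 mu 0.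
Proof. by apply/cL2P; split; exact: sqint0. Qed.

Lemma cL2_lin (c : R[i]) f g : cL2 mu f -> cL2 mu g -> cL2 mu (c *: f + g).
Proof.
move=> /cL2P[rf jf] /cL2P[rg jg]; apply/cL2P; case: c => a b; split.
  have := sqintDM 1 1 (sqintDM a (- b) rf jf) rg.
  congr sqint; apply/funext => w; rewrite cReD cReM/=; ring.
have := sqintDM 1 1 (sqintDM a b jf rf) jg.
congr sqint; apply/funext => w; rewrite cImD cImM/=; ring.
Qed.

Lemma L2ip_lin (c : R[i]) f g h : cL2 mu f -> cL2 mu g -> cL2 mu h ->
  L2ip (c *: f + g) h = c * L2ip f h + L2ip g h.
Proof.
move=> hf hg hh; rewrite /L2ip -cintegral_lin.
- congr cintegral; apply/funext => w.
  by rewrite mulrA -mulrDl.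
- by apply: cintegrable_mul => //; exact: cL2_conj.
- by apply: cintegrable_mul => //; exact: cL2_conj.
Qed.

Lemma L2ip_conj f g : cL2 mu f -> cL2 mu g -> L2ip g f = conjc (L2ip f g).
Proof.
move=> hf hg; rewrite -cintegral_conj.
  congr cintegral; apply/funext => w.
  by apply: complex_ext; rewrite !(cReM, cImM, cRe_conjc, cIm_conjc, cReD); ring.
by apply: cintegrable_mul => //; exact: cL2_conj.
Qed.

Lemma Re_L2ip f : complex.Re (L2ip f f) = fine (\int[mu]_w (csqr (f w))%:E)%E.
Proof.
congr fine; apply: eq_integral => w _; congr EFin.
by rewrite cReM cRe_conjc cIm_conjc /csqr; ring.
Qed.

Lemma L2ip_ge0 f : cL2 mu f -> 0 <= complex.Re (L2ip f f).
Proof.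
move=> _; rewrite Re_L2ip fine_ge0// integral_ge0// => w _.
by rewrite lee_fin csqr_ge0.
Qed.

Lemma cL2normE f : cL2norm mu f = Num.sqrt (complex.Re (L2ip f f)).
Proof.
rewrite /cL2norm cL2enormE fine_poweR powR12_sqrt -?Re_L2ip//.
rewrite Re_L2ip fine_ge0// integral_ge0// => w _.
by rewrite lee_fin csqr_ge0.
Qed.

Lemma EFin_L2ip f : cL2 mu f ->
  ((complex.Re (L2ip f f))%:E = \int[mu]_w (complex.Re (f w) ^+ 2)%:E +
    \int[mu]_w (complex.Im (f w) ^+ 2)%:E)%E.
Proof.
move=> hf; have [mf _] := hf; have /cL2P[[_ r2] [_ i2]] := hf.
rewrite -integral_csqrD// Re_L2ip fineK// ge0_fin_numE.
  by rewrite integral_csqrD// lte_add_pinfty.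
by apply: integral_ge0 => w _; rewrite lee_fin csqr_ge0.
Qed.

Lemma sqint_of_sqdist (f g : T -> R) : sqint mu f -> measurable_fun setT g ->
  (sqdist mu f g < +oo)%E -> sqint mu g.
Proof.
move=> hf mg fg.
have hfg : sqint mu (fun x => f x - g x).
  by split => //; apply: measurable_funB => //; exact: hf.1.
have := sqintDM 1 (-1) hf hfg; congr sqint; apply/funext => x; ring.
Qed.

Lemma cL2B f g : cL2 mu f -> cL2 mu g -> cL2 mu (f - g).
Proof.
by move=> hf hg; rewrite addrC -scaleN1r; exact: cL2_lin.
Qed.

Lemma EFin_L2ipB f g : cL2 mu f -> cL2 mu g ->
  ((complex.Re (L2ip (f - g) (f - g)))%:E =
    sqdist mu (fun w => complex.Re (f w)) (fun w => complex.Re (g w)) +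
    sqdist mu (fun w => complex.Im (f w)) (fun w => complex.Im (g w)))%E.
Proof.
move=> hf hg; rewrite EFin_L2ip; last exact: cL2B.
congr (_ + _)%E; apply: eq_integral => w _; congr EFin;
  by rewrite -[(f - g) w]/(f w - g w); case: (f w) (g w) => [a b] [a' b'].
Qed.

Lemma L2_complete (u : nat -> T -> R[i]) : (forall n, cL2 mu (u n)) ->
  (forall e : R, 0 < e -> exists N : nat, forall m n : nat,
     (N <= m)%N -> (N <= n)%N ->
     Num.sqrt (complex.Re (L2ip (u m - u n) (u m - u n))) < e) ->
  exists2 v, cL2 mu v &
    (fun n => Num.sqrt (complex.Re (L2ip (u n - v) (u n - v)))) @ \oo --> (0 : R).
Proof.
move=> hu Cu.
have sqd0 (f g : T -> R) : (0 <= sqdist mu f g)%E.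
  by apply: integral_ge0 => w _; rewrite lee_fin sqr_ge0.
have hr n : sqint mu (fun w => complex.Re (u n w)) by have /cL2P[] := hu n.
have hi n : sqint mu (fun w => complex.Im (u n w)) by have /cL2P[] := hu n.
have Cu2 (e : R) : 0 < e -> exists N : nat, forall m n : nat,
     (N <= m)%N -> (N <= n)%N ->
     (sqdist mu (fun w => complex.Re (u m w)) (fun w => complex.Re (u n w)) +
     sqdist mu (fun w => complex.Im (u m w)) (fun w => complex.Im (u n w)) < e%:E)%E.
  move=> e0; have [|N hN] := Cu (Num.sqrt e); first by rewrite sqrtr_gt0.
  exists N => m n Nm Nn; rewrite -EFin_L2ipB// lte_fin.
  by have := hN m n Nm Nn; rewrite ltr_sqrt.
have [|g1 mg1 cg1] := @sqdist_complete _ _ _ mu (fun n w => complex.Re (u n w))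
    (fun n => (hr n).1).
  move=> e /Cu2[N hN]; exists N => m n Nm Nn.
  by apply: le_lt_trans (hN m n Nm Nn); rewrite leeDl.
have [|g2 mg2 cg2] := @sqdist_complete _ _ _ mu (fun n w => complex.Im (u n w))
    (fun n => (hi n).1).
  move=> e /Cu2[N hN]; exists N => m n Nm Nn.
  by apply: le_lt_trans (hN m n Nm Nn); rewrite leeDr.
pose v w := g1 w +i* g2 w.
have hv : cL2 mu v.
  apply/cL2P; split.
    have [N hN] := cg1 1 ltr01.
    apply: (sqint_of_sqdist (hr N) mg1).
    by apply: le_lt_trans (hN N (leqnn N)) (ltry 1).
  have [N hN] := cg2 1 ltr01.
  apply: (sqint_of_sqdist (hi N) mg2).
  by apply: le_lt_trans (hN N (leqnn N)) (ltry 1).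
exists v => //; apply/cvgrPdist_lt => e e0.
have e20 : 0 < e ^+ 2 / 4 by rewrite divr_gt0// exprn_gt0.
have [N1 h1] := cg1 _ e20; have [N2 h2] := cg2 _ e20.
exists (maxn N1 N2) => // n /=; rewrite geq_max => /andP[n1 n2].
rewrite sub0r normrN ger0_norm ?sqrtr_ge0//.
rewrite -[e]ger0_norm ?(ltW e0)// -sqrtr_sqr ltr_sqrt ?exprn_gt0//.
rewrite -lte_fin EFin_L2ipB//.
apply: le_lt_trans (leeD (h1 n n1) (h2 n n2)) _.
by rewrite -EFinD lte_fin; have := exprn_gt0 2 e0; lra.
Qed.

Definition L2 : semi_hilbert (T -> R[i]) :=
  SemiHilbert cL2_0 cL2_lin L2ip_lin L2ip_conj L2ip_ge0 L2_complete.

End ComplexL2.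

(** * The theorem *)

Theorem corollary4p1 (R : realType) (d : measure_display)
    (T : measurableType d) (mu : {measure set T -> \bar R})
    (X : Type) (k : X -> T -> R[i])
    (hk : forall x : X, cL2 mu (k x)) :
  (exists H : hilbert_fun_space R X, is_rkhs (int_kernel mu k) H) /\
  (forall H : hilbert_fun_space R X, is_rkhs (int_kernel mu k) H ->
     carrier H = [set int_op mu k a | a in cL2 mu] /\
     forall f : X -> R[i], carrier H f ->
       hnorm H f =
         inf [set cL2norm mu a | a in
                [set a : T -> R[i] | cL2 mu a /\ int_op mu k a = f]]).
Proof.
(* The integral operator pairs [a] with [k y] bilinearly, whence the conjugate. *)
pose phi x : T -> R[i] := fun w => conjc (k x w).
have Dphi x : dom (L2 mu) (phi x) by exact/cL2_conj/hk.
have opE a : int_op mu k a = analysis (L2 mu) phi a.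
  apply/funext => y; congr cintegral; apply/funext => w.
  by rewrite conj_involutive.
have kerE : int_kernel mu k = fun x y => ip (L2 mu) (phi y) (phi x).
  apply/funext => x; apply/funext => y; congr cintegral; apply/funext => w.
  by rewrite conj_involutive mulrC.
have normE : cL2norm mu = fun a => Num.sqrt (sqn (L2 mu) a).
  by apply/funext => a; rewrite cL2normE.
have -> : int_op mu k = analysis (L2 mu) phi by exact/funext.
rewrite kerE normE; split; first by eexists; exact: range_space_is_rkhs.
exact: rkhs_range.
Qed.
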